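(* Let $G$ be a connected graph with $s$ vertices and $m$ edges, let $K$ be a field with ${\rm char}(K)=2$, and let $A$ be the incidence matrix of $G$ over $K$. Let $\mathbb{X}$ be the set of points of $\mathbb{P}^{s-1}$ defined by the column vectors of $A$, and let $\lambda_r(G)$ be the $r$-th edge connectivity of $G$. Then $\dim_K(C_\mathbb{X}(1))=s-1$, $\dim_K(C_\mathbb{X}(d))=m$ for all $d\geq 2$, and $$ \delta_\mathbb{X}(d,r)=\begin{cases} \lambda_r(G)&\text{if }d=1\text{ and }1\leq r\leq s-1,\\ r&\text{if } d\geq 2\text{ and }1\leq r\leq m. \end{cases} $$
   Context: Graphs are finite and simple. Let $G$ be a graph with vertices $t_1,\ldots,t_s$ and edges $f_1,\ldots,f_m$. The incidence matrix of $G$ is the $s\times m$ matrix $A=(a_{ij})$ over $K$ with $a_{ij}=1$ if $t_i\in f_j$ and $a_{ij}=0$ otherwise. Let $P_1,\ldots,P_m\in K^s$ be its columns and $\mathbb{X}=\{[P_1],\ldots,[P_m]\}\subset\mathbb{P}^{s-1}$ the corresponding set of points in projective space over $K$. The $r$-th edge connectivity $\lambda_r(G)$ is the minimum number of edges of $G$ whose removal results in a graph with $r+1$ connected components. Let $S=K[t_1,\ldots,t_s]=\bigoplus_{d\geq 0}S_d$ with the standard grading (the vertices are identified with the variables). The vanishing ideal $I(\mathbb{X})$ is the graded ideal of $S$ generated by the homogeneous polynomials vanishing at all points of $\mathbb{X}$. For a finite set $F$ of homogeneous polynomials, $V_\mathbb{X}(F)$ is the set of common zeros of $F$ in $\mathbb{X}$.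 For integers $d,r\geq 1$, $$\delta_\mathbb{X}(d,r)=\min\{|\mathbb{X}\setminus V_\mathbb{X}(F)| : F=\{f_i\}_{i=1}^r\subset S_d,\ \dim_K(\{\overline{f}_i\}_{i=1}^r)=r\},$$ where $\overline{f}_i=f_i+I(\mathbb{X})$ and $\dim_K(\{\overline f_i\}_{i=1}^r)$ is the dimension of the $K$-span of these classes in $S/I(\mathbb{X})$. The projective Reed--Muller-type code $C_\mathbb{X}(d)$ is the image of the linear map ${\rm ev}_d\colon S_d\to K^m$, $f\mapsto(f(P_1),\ldots,f(P_m))$. *)

(* Defs.v *)
From HB Require Import structures.
From mathcomp Require Import all_boot all_order all_algebra.
From mathcomp Require Import finmap mpoly.

Set Implicit Arguments.
Unset Strict Implicit.
Unset Printing Implicit Defensive.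

Import GRing.Theory.
Local Open Scope ring_scope.

(* Relational: the minimum of an empty set of naturals does not exist. *)
Definition is_min (P : nat -> Prop) (k : nat) : Prop :=
  P k /\ forall j, P j -> (k <= j)%N.

Record sgraph (s m : nat) := SGraph {
  edge :> 'I_m -> {set 'I_s};
  edge_card : forall j, #|edge j| = 2%N;
  edge_inj : injective edge
}.

Section Graph.
Variables (s m : nat) (G : sgraph s m).

(* Adjacency in the graph obtained from G by removing the edges in B, the
   vertex set being kept. *)
Definition del_adj (B : {set 'I_m}) : rel 'I_s :=
  fun x y => [exists j : 'I_m, (j \notin B) && (G j == [set x; y])].

Definition connected_graph : Prop :=
  (0 < s)%N /\ forall x y, connect (del_adj set0) x y.

Definition is_edge_connectivity (r : nat) : nat -> Prop :=
  is_min (fun k => exists2 B : {set 'I_m},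
    n_comp (del_adj B) 'I_s = r.+1 & #|B| = k).

Definition incidence_mx (K : fieldType) : 'M[K]_(s, m) :=
  \matrix_(i, j) (i \in G j)%:R.

End Graph.

(* A point of the projective space P^(s-1) is represented by the line of K^s
   that it spans. *)
Definition proj_points (K : fieldType) (s m : nat) (A : 'M[K]_(s, m)) :
    {fset {vspace 'cV[K]_s}} :=
  [fset <[col j A]>%VS | j in 'I_m]%fset.

Section ProjectiveSet.
Variables (K : fieldType) (s : nat) (X : {fset {vspace 'cV[K]_s}}).

(* vpick L is a nonzero vector of the line L; for homogeneous f the choice of
   this representative is irrelevant. *)
Definition vanishes_at (f : {mpoly K[s]}) (L : {vspace 'cV[K]_s}) : bool :=
  f.@[fun i => vpick L i 0] == 0.

Definition zero_set (I : finType) (F : I -> {mpoly K[s]}) :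
    {fset {vspace 'cV[K]_s}} :=
  [fset L in X | [forall i, vanishes_at (F i) L]]%fset.

Definition homog_vanishing (h : {mpoly K[s]}) : Prop :=
  (exists d, h \is d.-homog) /\ forall L, L \in X -> vanishes_at h L.

Definition vanishing_ideal (p : {mpoly K[s]}) : Prop :=
  exists n, exists2 qh : 'I_n -> {mpoly K[s]} * {mpoly K[s]},
    forall i, homog_vanishing (qh i).2
    & p = \sum_i (qh i).1 * (qh i).2.

(* The K-span of the classes of the f i in the quotient by the vanishing ideal
   has dimension k: the classes of some b 0, ..., b (k - 1), where the b j are
   linear combinations of the f i, form a basis of it. *)
Definition quot_span_dim (r : nat) (f : 'I_r -> {mpoly K[s]}) (k : nat) : Prop :=
  exists b : 'I_k -> {mpoly K[s]},
    [/\ forall j, exists c : 'I_r -> K, b j = \sum_i c i *: f i,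
        forall i, exists c : 'I_k -> K,
          vanishing_ideal (f i - \sum_j c j *: b j)
      & forall c : 'I_k -> K,
          vanishing_ideal (\sum_j c j *: b j) -> forall j, c j = 0].

Definition is_ghw (d r : nat) : nat -> Prop :=
  is_min (fun k => exists F : 'I_r -> {mpoly K[s]},
    [/\ forall i, F i \is d.-homog,
        quot_span_dim F r
      & #|` (X `\` zero_set F)%fset| = k]).

End ProjectiveSet.

Section Code.
Variables (K : fieldType) (n m : nat) (A : 'M[K]_(n.+1, m)) (d : nat).

Definition evaluation (f : dhomog n.+1 K d) : 'rV[K]_m :=
  \row_j (f : {mpoly K[n.+1]}).@[fun i => A i j].

Fact evaluation_is_linear : linear evaluation.
Proof. by move=> a f g; apply/rowP => j; rewrite !mxE mevalD mevalZ. Qed.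

HB.instance Definition _ := GRing.isLinear.Build K (dhomog n.+1 K d) 'rV[K]_m _
  evaluation evaluation_is_linear.

Definition RM_code : {vspace 'rV[K]_m} := limg (linfun evaluation).

End Code.

(* Main.v *)
Require Import Defs.
From mathcomp Require Import all_boot all_order all_algebra.
From mathcomp Require Import finmap mpoly.

(** The r-th minimum is a statement about row spaces. Evaluating forms of degree
    d at the columns of the incidence matrix A identifies the degree d part of
    S / I(X) with a space of row vectors, and turns the number of points of X
    that are not zeros of F into the number of nonzero columns of the matrix of
    evaluations of F. So the r-th value is the least support size of an
    r-dimensional subspace of the code (is_ghwE).

    For d >= 2 the form x^(d-1) y, where {x, y} is an edge, takes the value 1 at
    the point of that edge and 0 at all others, so the code is the whole space
    K^m, in which an r-dimensional subspace has support at least r, with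
    equality for the span of r unit vectors.

    For d = 1 the code is the row space of A. A row vector u is a function on
    the vertices and, as the characteristic is 2, the entry of u A at an edge
    {x, y} is u x + u y = u x - u y. Hence for a set B of edges, the u for which
    u A is supported in B are the functions that are constant on the components
    of G minus B. Writing c(B) for the number of these components, the u form a
    space of dimension c(B) (n_comp_kernel) that contains the kernel of the map
    u |-> u A, which is the line of constant functions because G is connected.
    Therefore the codewords supported in B form a space of dimension c(B) - 1
    (rank_cut_code). Thus a cut B into r + 1 components carries an r-dimensional
    subcode supported in B, and the support of an r-dimensional subcode is a cut
    into at least r + 1 components. Putting removed edges back one at a time
    lowers c by at most 1 at each step and ends with c = 1, so the latter cut
    contains one into exactly r + 1 components (exact_subcut). The two minima
    are therefore equal. *)

Set Implicit Arguments.
Unset Strict Implicit.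
Unset Printing Implicit Defensive.

Import GRing.Theory.
Local Open Scope ring_scope.

(** * Support of a matrix *)

Section MatrixSupport.
Variables (K : fieldType) (r m : nat).

Definition support (D : 'M[K]_(r, m)) : {set 'I_m} := [set j | col j D != 0].

Lemma supportP (D : 'M[K]_(r, m)) j :
  reflect (exists i, D i j != 0) (j \in support D).
Proof.
rewrite inE; apply: (iffP idP) => [|[i Dij]].
  move=> Dj; apply/existsP; apply: contraNT Dj => /existsPn Dj.
  by apply/eqP/colP => i; rewrite !mxE; apply/eqP/negPn/Dj.
by apply: contraNneq Dij => /colP/(_ i); rewrite !mxE => ->.
Qed.

(** The matrix factors through its nonzero columns. *)
Lemma rank_le_support (D : 'M[K]_(r, m)) : (\rank D <= #|support D|)%N.
Proof.
pose S := support D.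
pose E : 'M[K]_(#|S|, m) := \matrix_(k, j) (enum_val k == j)%:R.
suff DE : D = colsub (@enum_val _ (mem S)) D *m E.
  by rewrite {1}DE mulmx_max_rank.
apply/matrixP => i j; rewrite mxE.
have [Sj|Sj] := boolP (j \in S).
  rewrite (bigD1 (enum_rank_in Sj j)) //= !mxE enum_rankK_in // eqxx mulr1.
  rewrite big1 ?addr0 // => k neq_k; rewrite !mxE.
  have [kj|_] := eqVneq (enum_val k) j; last by rewrite mulr0.
  by case/eqP: neq_k; apply: enum_val_inj; rewrite enum_rankK_in.
rewrite big1 => [|k _].
  by apply/eqP/negPn; apply: contra Sj => Dij; apply/supportP; exists i.
rewrite !mxE; have [kj|_] := eqVneq (enum_val k) j; last by rewrite mulr0.
by rewrite -kj enum_valP in Sj.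
Qed.

End MatrixSupport.

(** * Evaluation codes and their generalized Hamming weights *)

Section EvaluationCode.
Variables (K : fieldType) (s m : nat) (A : 'M[K]_(s, m)).

Definition eval_cols (f : {mpoly K[s]}) : 'rV[K]_m :=
  \row_j f.@[fun i => A i j].

Lemma eval_cols_sum (I : finType) (c : I -> K) (f : I -> {mpoly K[s]}) :
  eval_cols (\sum_i c i *: f i) = \sum_i c i *: eval_cols (f i).
Proof.
apply/rowP => j; rewrite summxE !mxE raddf_sum /=; apply: eq_bigr => i _.
by rewrite mevalZ !mxE.
Qed.

Lemma dhomog_lin_comb (I : finType) (c : I -> K) (f : I -> {mpoly K[s]}) d :
  (forall i, f i \is d.-homog) -> \sum_i c i *: f i \is d.-homog.
Proof. by move=> homf; apply: rpred_sum => i _; apply: dhomogZ. Qed.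

(** A generator matrix M, possibly with dependent rows, of the code formed by
    the evaluations of the forms of degree d. *)
Definition generates_code d k (M : 'M[K]_(k, m)) : Prop :=
  forall v : 'rV[K]_m,
    (v <= M)%MS <-> exists2 f, f \is d.-homog & eval_cols f = v.

Lemma eval_homog_scale d (f : {mpoly K[s]}) (c : K) (v : 'I_s -> K) :
  f \is d.-homog -> f.@[fun i => c * v i] = c ^+ d * f.@[v].
Proof.
move=> /dhomogP homf; rewrite mevalE [in RHS]mevalE mulr_sumr.
rewrite big_seq_cond [RHS]big_seq_cond.
apply: eq_bigr => u; rewrite andbT => /homf <-.
rewrite [RHS]mulrCA; congr (_ * _).
rewrite /= mdegE -prodrXr -big_split /=.
by apply: eq_bigr => i _; rewrite exprMn.
Qed.

Lemma in_zero_set (X : {fset {vspace 'cV[K]_s}}) (I : finType)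
    (F : I -> {mpoly K[s]}) L :
  (L \in zero_set X F) = (L \in X) && [forall i, vanishes_at (F i) L].
Proof. by rewrite /zero_set !inE. Qed.

Lemma col_proj_points j : <[col j A]>%VS \in proj_points A.
Proof. by apply/imfsetP; exists j. Qed.

Section DistinctPoints.
Hypotheses (colA_neq0 : forall j, col j A != 0).
Hypotheses (colA_inj : injective (fun j => <[col j A]>%VS)).

(** The chosen representative of the point is a nonzero multiple of the column,
    so the two values of f differ by the d-th power of a nonzero factor. *)
Lemma vanishes_at_col d (f : {mpoly K[s]}) j : f \is d.-homog ->
  vanishes_at f <[col j A]>%VS = (eval_cols f 0 j == 0).
Proof.
move=> homf; have /vlineP[c pickE] := memv_pick <[col j A]>%VS.
have c_neq0 : c != 0.
  have: vpick <[col j A]>%VS != 0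
    by rewrite vpick0 -dimv_eq0 dim_vline colA_neq0.
  by apply: contraNneq => c0; rewrite pickE c0 scale0r.
rewrite /vanishes_at pickE mxE.
rewrite (@meval_eq _ _ _ (fun i => c * A i j)) => [|i]; last by rewrite !mxE.
by rewrite (eval_homog_scale _ _ homf) mulf_eq0 expf_eq0 (negPf c_neq0) andbF.
Qed.

(** Every element of the ideal vanishes at every representative; conversely
    a form that vanishes on X is itself one of the generators. *)
Lemma vanishing_idealE d (f : {mpoly K[s]}) : f \is d.-homog ->
  vanishing_ideal (proj_points A) f <-> eval_cols f = 0.
Proof.
move=> homf; split=> [[k [qh homqh fE]]|f0].
  apply/rowP => j; apply/eqP; rewrite [X in _ == X]mxE.
  rewrite -(vanishes_at_col j homf).
  rewrite fE /vanishes_at raddf_sum /= big1 // => i _; rewrite mevalM.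
  have [_ /(_ _ (col_proj_points j))/eqP->] := homqh i.
  by rewrite mulr0.
exists 1%N, (fun=> (1, f)); last by rewrite big_ord1 mul1r.
move=> _; split=> [|_ /imfsetP[j _ ->]]; first by exists d.
by rewrite (vanishes_at_col j homf) f0 mxE.
Qed.

Lemma card_nonzeros d r (F : 'I_r -> {mpoly K[s]}) :
  (forall i, F i \is d.-homog) ->
  #|` (proj_points A `\` zero_set (proj_points A) F)%fset|
    = #|support (\matrix_i eval_cols (F i))|.
Proof.
move=> homF; set S := support _.
suff -> : (proj_points A `\` zero_set (proj_points A) F)%fset
          = [fset <[col j A]>%VS | j in S]%fset.
  by rewrite card_imfset ?cardE.
apply/fsetP => L; rewrite in_fsetD in_zero_set.
apply/andP/imfsetP => [[+ /imfsetP[j _ LE]]|[j /= Sj LE]].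
  rewrite LE col_proj_points /= => /forallPn[i nz]; exists j => //=.
  by apply/supportP; exists i; rewrite mxE -(vanishes_at_col j (homF i)).
rewrite LE col_proj_points /=; split=> //=; apply/forallPn.
have /supportP[i nz] := Sj; exists i.
by rewrite (vanishes_at_col j (homF i)); rewrite mxE in nz.
Qed.

(** By vanishing_idealE, evaluation embeds the degree d part of S / I(X) into
    K^m, so dimensions may be computed after evaluation. *)
Lemma row_free_quot_span_dim d r (F : 'I_r -> {mpoly K[s]}) :
  (forall i, F i \is d.-homog) ->
  quot_span_dim (proj_points A) F r <->
  row_free (\matrix_i eval_cols (F i)).
Proof.
move=> homF; set D := \matrix_i _;
have DE c : c *m D = eval_cols (\sum_i c 0 i *: F i).
  by rewrite eval_cols_sum mulmx_sum_row; under eq_bigr do rewrite rowK.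
split=> [[b [bF _ b_indep]]|freeD].
  have [c bE] := fin_all_exists bF.
  have homb j : b j \is d.-homog by rewrite bE; apply: dhomog_lin_comb.
  (* The evaluations of the basis b are r independent combinations of the r rows
     of D, which forces D to have rank r. *)
  pose C := \matrix_(j, i) c j i.
  suff freeCD : row_free (C *m D).
    by rewrite /row_free eqn_leq rank_leq_row -{1}(eqP freeCD) mxrankM_maxr.
  have CDE : C *m D = \matrix_j eval_cols (b j).
    apply/row_matrixP => j; rewrite row_mul DE rowK bE.
    by congr eval_cols; apply: eq_bigr => i _; rewrite !mxE.
  apply: inj_row_free => v; rewrite CDE mulmx_sum_row => v0.
  apply/rowP => j; rewrite mxE; apply: (b_indep (v 0)).
  apply/(vanishing_idealE (dhomog_lin_comb _ homb));
  rewrite eval_cols_sum -[RHS]v0.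
  by apply: eq_bigr => i _; rewrite rowK.
exists F; split=> [j|i|c Fc j].
- exists (fun i => (i == j)%:R); rewrite (bigD1 j) //= eqxx scale1r.
  rewrite big1 ?addr0 //.
  by move=> i /negPf ->; rewrite scale0r.
- exists (fun j => (j == i)%:R); rewrite (bigD1 i) //= eqxx scale1r big1 ?addr0.
    rewrite subrr; exists 0, (fun=> (0, 0)); last by rewrite big_ord0.
    by case.
  by move=> j /negPf ->; rewrite scale0r.
have := (vanishing_idealE (dhomog_lin_comb c homF)).1 Fc.
have -> : eval_cols (\sum_j c j *: F j) = (\row_j c j) *m D.
  by rewrite DE; congr eval_cols; apply: eq_bigr => i _; rewrite mxE.
move/eqP; rewrite mulmx_free_eq0 // => /eqP/rowP/(_ j).
by rewrite !mxE.
Qed.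

(** This eliminates polynomials: only a generator matrix of the code matters. *)
Lemma is_ghwE d r k (M : 'M[K]_(k, m)) l : generates_code d M ->
  is_ghw (proj_points A) d r l <->
  is_min (fun w => exists D : 'M[K]_(r, m),
    [/\ (D <= M)%MS, row_free D & #|support D| = w]) l.
Proof.
move=> genM.
have min_ext (P Q : nat -> Prop) :
    (forall j, P j <-> Q j) -> is_min P l <-> is_min Q l.
  by move=> PQ; split=> -[/PQ Pl minl]; split=> // j /PQ /minl.
apply: min_ext => w; split=> [[F [homF dimF <-]]|[D [DM freeD <-]]].
  exists (\matrix_i eval_cols (F i)); split.
  - by apply/row_subP => i; rewrite rowK; apply/genM; exists (F i).
  - exact/(row_free_quot_span_dim homF).
  - by rewrite (card_nonzeros homF).
have rowD i : exists f, f \is d.-homog /\ eval_cols f = row i D.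
  have /genM[f homf fE] : (row i D <= M)%MS
    by apply: submx_trans DM; apply: row_sub.
  by exists f.
have [F homF] := fin_all_exists rowD.
have DE : D = \matrix_i eval_cols (F i).
  by apply/row_matrixP => i; rewrite rowK; case: (homF i).
have hF i : F i \is d.-homog by case: (homF i).
exists F; rewrite (card_nonzeros hF) -DE; split=> //.
by apply/(row_free_quot_span_dim hF); rewrite -DE.
Qed.

End DistinctPoints.

Lemma linear_form_sum (f : {mpoly K[s]}) :
  f \is 1.-homog -> f = \sum_i f@_U_(i) *: 'X_i.
Proof.
move=> homf; apply/mpolyP => u; rewrite raddf_sum /=.
have [/mdeg1P[i /eqP->]|deg_u] := boolP (mdeg u == 1%N).
  rewrite (bigD1 i) //= mcoeffZ mcoeffX eqxx mulr1 big1 ?addr0 // => j ji.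
  rewrite mcoeffZ mcoeffX; case: eqP => [/mnmP/(_ j)|_]; last by rewrite mulr0.
  by rewrite !mnm1E eqxx eq_sym (negPf ji).
rewrite (dhomog_nemf_coeff homf deg_u) big1 // => i _.
rewrite mcoeffZ mcoeffX; case: eqP => [uE|_]; last by rewrite mulr0.
by rewrite -uE mdeg1 in deg_u.
Qed.

Lemma eval_linear_form (f : {mpoly K[s]}) :
  f \is 1.-homog -> eval_cols f = (\row_i f@_U_(i)) *m A.
Proof.
move=> /linear_form_sum fE; rewrite {1}fE eval_cols_sum mulmx_sum_row.
apply: eq_bigr => i _; rewrite mxE; congr (_ *: _).
by apply/rowP => j; rewrite !mxE mevalXU.
Qed.

(** The linear form with coefficient vector u evaluates to u A. *)
Lemma generates_linear_forms : generates_code 1 A.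
Proof.
move=> v; split=> [/submxP[u ->]|[f homf <-]]; last first.
  by rewrite (eval_linear_form homf) submxMl.
have homU : \sum_i u 0 i *: 'X_i \is 1.-homog.
  by apply: dhomog_lin_comb => i; rewrite dhomogX /= mdeg1.
exists (\sum_i u 0 i *: 'X_i) => //; rewrite eval_cols_sum mulmx_sum_row.
by apply: eq_bigr => i _; congr (_ *: _); apply/rowP => j; rewrite !mxE mevalXU.
Qed.

End EvaluationCode.

(** A row base of M parametrizes the code injectively. *)
Lemma dim_RM_code (K : fieldType) n m (A : 'M[K]_(n.+1, m)) d k
    (M : 'M[K]_(k, m)) :
  generates_code A d M -> \dim (RM_code A d) = \rank M.
Proof.
move=> genM; set R := row_base M;
pose phi := linfun (mulmxr R : 'rV_(\rank M) -> 'rV_m).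
have -> : RM_code A d = limg phi.
  apply/vspaceP => v; apply/memv_imgP/memv_imgP => [[f _ ->]|[u _ ->]].
    have: (eval_cols A (val f) <= R)%MS.
      rewrite eq_row_base; apply/genM; exists (val f) => //.
      exact: dhomog_is_dhomog.
    by case/submxP => u uE; exists u; rewrite ?memvf // !lfunE /= -uE.
  have /genM[f homf fE] : (u *m R <= M)%MS by rewrite -(eq_row_base M) submxMl.
  by exists (DHomog homf); rewrite ?memvf // !lfunE.
rewrite limg_dim_eq; first by rewrite dimvf /dim /= mul1n.
apply/eqP; rewrite capfv; apply/lker0P => u v; rewrite !lfunE /=.
exact/row_free_inj/row_base_free.
Qed.

(** * Components and the incidence matrix in characteristic 2 *)

Section Graphs.
Variables (s m : nat) (G : sgraph s m).

Lemma edgeP j : exists x y, x != y /\ G j = [set x; y].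
Proof. by apply/cards2P/eqP/edge_card. Qed.

Lemma del_adj_sym B : connect_sym (del_adj G B).
Proof.
apply: sym_connect_sym => x y; rewrite /del_adj.
by apply: eq_existsb => j; rewrite setUC.
Qed.

Lemma n_comp_roots B : n_comp (del_adj G B) 'I_s = #|roots (del_adj G B)|.
Proof. by apply: eq_card => x; rewrite !inE andbT. Qed.

Lemma n_comp_connected :
  connected_graph G -> n_comp (del_adj G set0) 'I_s = 1%N.
Proof.
case=> s_gt0 connG; rewrite n_comp_roots; pose x := Ordinal s_gt0.
apply/eqP; rewrite -(cards1 (fingraph.root (del_adj G set0) x)) -cardsE.
apply/eqP; congr #|pred_of_set _|; apply/setP => y; rewrite !inE.
apply/idP/eqP => [/eqP<-|->].
  by apply/eqP; rewrite root_connect ?connG //; exact: del_adj_sym.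
exact/roots_root/del_adj_sym.
Qed.

Lemma n_comp_discrete : n_comp (del_adj G setT) 'I_s = s.
Proof.
rewrite n_comp_roots -[RHS]card_ord; apply: eq_card => x.
rewrite [RHS]inE; apply/eqP.
have /connectP[[|y p]] := connect_root (del_adj G setT) x; first by [].
by case/andP => /existsP[j]; rewrite inE.
Qed.

Section Char2.
Variables (K : fieldType) (char2 : 2%N \in [pchar K]%R).
Let A := incidence_mx G K.

Lemma col_incidence_neq0 j : col j A != 0.
Proof.
have [x [y [_ Gj]]] := edgeP j.
apply/eqP => /colP/(_ x)/eqP; rewrite !mxE Gj !inE eqxx /=.
by rewrite oner_eq0.
Qed.

Lemma col_incidence_inj : injective (fun j => <[col j A]>%VS).
Proof.
move=> j k /= jk; apply: (@edge_inj s m G); apply/setP => x.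
have /vlineP[c /colP/(_ x)] : col j A \in <[col k A]>%VS.
  by rewrite -jk memv_line.
have /vlineP[e /colP/(_ x)] : col k A \in <[col j A]>%VS.
  by rewrite jk memv_line.
rewrite !mxE; case: (x \in G j); case: (x \in G k) => //=.
  by move=> _ /eqP; rewrite mulr0 oner_eq0.
by move=> /eqP; rewrite mulr0 oner_eq0.
Qed.

Lemma mul_incidence (u : 'rV[K]_s) j x y :
  x != y -> G j = [set x; y] -> (u *m A) 0 j = u 0 x + u 0 y.
Proof.
move=> xy Gj; rewrite mxE (bigID (mem (G j))) /= [X in _ + X]big1 => [|i iGj].
  rewrite addr0 Gj big_setU1 ?inE //= big_set1 !mxE Gj !inE !eqxx orbT.
  by rewrite !mulr1.
by rewrite mxE (negPf iGj) mulr0.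
Qed.

(** Characteristic 2 turns the unsigned incidence matrix into a coboundary. *)
Lemma mul_incidence_eq0 (u : 'rV[K]_s) j x y :
  G j = [set x; y] -> ((u *m A) 0 j == 0) = (u 0 x == u 0 y).
Proof.
move=> Gj; have xy : x != y.
  by move: (edge_card G j); rewrite Gj cards2; case: (x != y).
by rewrite (mul_incidence u xy Gj) addr_eq0 (oppr_pchar2 char2).
Qed.

(** The incidence matrix of G minus B, in which the removed edges are kept as
    zero columns so that the width does not depend on B. *)
Definition kept_mx (B : {set 'I_m}) : 'M[K]_(s, m) :=
  \matrix_(i, j) (if j \in B then 0 else A i j).

Lemma mul_kept_mx k (U : 'M[K]_(k, s)) B i j :
  (U *m kept_mx B) i j = if j \in B then 0 else (U *m A) i j.
Proof.
rewrite !mxE; case: ifP => Bj.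
  by apply: big1 => x _; rewrite mxE Bj mulr0.
by apply: eq_bigr => x _; rewrite !mxE Bj.
Qed.

Lemma kept_mx0 : kept_mx set0 = A.
Proof. by apply/matrixP => i j; rewrite mxE inE. Qed.

(** A function that agrees at the ends of every kept edge is constant on
    components, that is, determined by its values at the roots. *)
Lemma ker_kept_mxP (u : 'rV[K]_s) B :
  u *m kept_mx B = 0 <->
  forall x, u 0 x = u 0 (fingraph.root (del_adj G B) x).
Proof.
split=> [u0 x|u_root].
  have := connect_root (del_adj G B) x.
  move: (fingraph.root _ x) => t /connectP[p].
  elim: p x => /= [|y p IHp] x; first by move=> _ ->.
  case/andP=> /existsP[j /andP[Bj /eqP Gj]] yp tE.
  rewrite -(IHp y yp tE); apply/eqP; rewrite -(mul_incidence_eq0 u Gj).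
  by move/rowP/(_ j): u0; rewrite mul_kept_mx (negPf Bj) [X in _ = X]mxE => ->.
apply/rowP => j; rewrite mul_kept_mx [RHS]mxE; case: ifPn => // Bj.
have [x [y [_ Gj]]] := edgeP j; apply/eqP; rewrite (mul_incidence_eq0 u Gj).
rewrite u_root (u_root y); apply/eqP; congr (u 0 _); apply/eqP.
rewrite root_connect; last exact: del_adj_sym.
by apply: connect1; apply/existsP; exists j; rewrite Bj Gj /=.
Qed.

(** The kernel consists of the functions constant on components, and the
    indicator functions of the components, the rows of N below, are a basis. *)
Lemma n_comp_kernel B : n_comp (del_adj G B) 'I_s = \rank (kermx (kept_mx B)).
Proof.
rewrite n_comp_roots; set e := del_adj G B; have e_sym := @del_adj_sym B.
pose R := roots e.
pose N : 'M[K]_(#|R|, s) :=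
  \matrix_(i, x) (fingraph.root e x == enum_val i)%:R.
have freeN : row_free N.
  apply/row_freeP; exists (\matrix_(x, i) (x == enum_val i)%:R).
  apply/matrixP => i k; rewrite !mxE (bigD1 (enum_val k)) //= !mxE eqxx mulr1.
  rewrite (eqP (enum_valP k)) (inj_eq enum_val_inj) eq_sym.
  rewrite big1 ?addr0 // => x xk.
  by rewrite !mxE (negPf xk) mulr0.
rewrite -(eqP freeN); apply/eqmx_rank/andP; split.
  apply/sub_kermxP/row_matrixP => i; rewrite row_mul row0.
  by apply/ker_kept_mxP => x; rewrite !mxE root_root.
apply/row_subP => i; have : row i (kermx (kept_mx B)) *m kept_mx B = 0.
  by rewrite -row_mul mulmx_ker row0.
move: (row i _) => u /ker_kept_mxP u_root.
have -> : u = \sum_k u 0 (enum_val k) *: row k N.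
  apply/rowP => x; rewrite u_root summxE.
  have Rx : fingraph.root e x \in R := roots_root e_sym x.
  rewrite (bigD1 (enum_rank_in Rx (fingraph.root e x))) //= !mxE.
  rewrite enum_rankK_in // eqxx mulr1 big1 ?addr0 // => k k_x; rewrite !mxE.
  have [xk|_] := eqVneq (fingraph.root e x) (enum_val k); last by rewrite mulr0.
  by case/eqP: k_x; apply: enum_val_inj; rewrite enum_rankK_in.
by apply: summx_sub => k _; apply/scalemx_sub/row_sub.
Qed.

(** Putting the edge j back changes one column of the matrix, hence its rank by
    at most 1. *)
Lemma n_comp_setD1 B j :
  (n_comp (del_adj G B) 'I_s <= (n_comp (del_adj G (B :\ j)) 'I_s).+1)%N.
Proof.
rewrite !n_comp_kernel !mxrank_ker.
pose C := kept_mx (B :\ j) - kept_mx B.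
have rankC : (\rank C <= 1)%N.
  apply: leq_trans (rank_le_support C) _; rewrite -(cards1 j).
  apply/subset_leq_card/subsetP => k /supportP[i]; rewrite !mxE !inE.
  by have [//|_] := eqVneq k j; rewrite /= subrr eqxx.
have := leq_trans (mxrank_add (kept_mx B) C) (leq_add (leqnn _) rankC).
rewrite addrC subrK addn1 => rank_le.
rewrite leq_subLR addnS -addSn; apply: leq_trans (leq_add rank_le (leqnn _)).
by rewrite -leq_subLR.
Qed.

(** * Edge cuts and subcodes *)

Hypothesis connG : connected_graph G.

(** A discrete intermediate value argument: put edges of B back one at a time.
    The count drops by at most 1 each time and finally reaches 1, so it takes
    the value r + 1. *)
Lemma exact_subcut r (B : {set 'I_m}) : (r < n_comp (del_adj G B) 'I_s)%N ->
  exists2 B' : {set 'I_m},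
    B' \subset B & n_comp (del_adj G B') 'I_s = r.+1.
Proof.
have [k] := ubnP #|B|; elim: k B => // k IHk B; rewrite ltnS => cardB.
rewrite leq_eqVlt => /predU1P[nB|r_lt]; first by exists B.
have [B0|[j Bj]] := set_0Vmem B.
  by move: r_lt; rewrite B0 n_comp_connected.
case: (IHk (B :\ j)) => [||B' sB' nB'].
- by apply: leq_trans cardB; apply/proper_card/properD1.
- by rewrite -ltnS; apply: leq_trans (n_comp_setD1 B j).
by exists B' => //; apply: subset_trans sB' (subD1set B j).
Qed.

Lemma rank_ker_incidence : \rank (kermx A) = 1%N.
Proof. by rewrite -kept_mx0 -n_comp_kernel n_comp_connected. Qed.

Lemma ker_incidence_kept B : (kermx A <= kermx (kept_mx B))%MS.
Proof.
apply/sub_kermxP/matrixP => i j; rewrite mul_kept_mx mulmx_ker mxE.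
by case: ifP; rewrite // mxE.
Qed.

(** The space of codewords supported in B is the image under A of the functions
    constant on the components of G minus B, and only the line of globally
    constant functions is lost. *)
Lemma rank_cut_code B :
  \rank (kermx (kept_mx B) *m A) = (n_comp (del_adj G B) 'I_s).-1.
Proof.
rewrite n_comp_kernel -(mxrank_mul_ker _ A).
by rewrite (capmx_idPr (ker_incidence_kept B)) rank_ker_incidence addn1.
Qed.

(** This identifies the space of the previous lemma as the subcode supported
    in B. *)
Lemma sub_cut_codeP k (D : 'M[K]_(k, m)) B :
  (D <= kermx (kept_mx B) *m A)%MS <-> (D <= A)%MS /\ support D \subset B.
Proof.
split=> [|[/submxP[U DE] /subsetP sDB]].
  case/submxP=> X; rewrite mulmxA => DE; split; first by rewrite DE submxMl.
  apply/subsetP => j /supportP[i]; apply: contraR => Bj.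
  have := mul_kept_mx (X *m kermx (kept_mx B)) B i j.
  by rewrite (negPf Bj) -DE -mulmxA mulmx_ker mulmx0 mxE => <-.
rewrite DE submxMr //; apply/sub_kermxP/matrixP => i j.
rewrite mul_kept_mx -DE [RHS]mxE; case: ifPn => // Bj; apply/eqP.
by apply: contraNT Bj => Dij; apply: sDB; apply/supportP; exists i.
Qed.

(** The subcode supported in B has dimension r and yields D. *)
Lemma cut_subcode r B : n_comp (del_adj G B) 'I_s = r.+1 ->
  exists D : 'M[K]_(r, m), [/\ (D <= A)%MS, row_free D & support D \subset B].
Proof.
move=> nB; set C := kermx (kept_mx B) *m A.
have rankC : \rank C = r by rewrite rank_cut_code nB.
pose D : 'M[K]_(r, m) := pid_mx r *m row_base C.
have [DA suppD] : (D <= A)%MS /\ support D \subset B.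
  by apply/sub_cut_codeP; rewrite -/C -(eq_row_base C) submxMl.
exists D; split=> //; rewrite /row_free mxrankMfree ?row_base_free //.
by rewrite rank_pid_mx // rankC.
Qed.

(** The support of D is a cut into at least r + 1 components, since the subcode
    that it supports has dimension at least r; it is then thinned out. *)
Lemma subcode_cut r (D : 'M[K]_(r, m)) : (D <= A)%MS -> row_free D ->
  exists2 B : {set 'I_m},
    B \subset support D & n_comp (del_adj G B) 'I_s = r.+1.
Proof.
move=> DA /eqP rankD; apply: exact_subcut.
have : (D <= kermx (kept_mx (support D)) *m A)%MS by apply/sub_cut_codeP.
move/mxrankS; rewrite rankD rank_cut_code => r_le.
have : (0 < n_comp (del_adj G (support D)) 'I_s)%N.
  by rewrite n_comp_kernel -rank_ker_incidence mxrankS // ker_incidence_kept.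
by move/prednK <-; rewrite ltnS.
Qed.

(** Removing all edges leaves s components, so the minimum over cuts exists; the
    two preceding lemmas bound each minimum by the other. *)
Lemma edge_connectivity_code r : (r < s)%N ->
  exists2 l, is_edge_connectivity G r l &
    is_min (fun w => exists D : 'M[K]_(r, m),
      [/\ (D <= A)%MS, row_free D & #|support D| = w]) l.
Proof.
move=> r_lt.
have [B _ nB] : exists2 B : {set 'I_m},
    B \subset setT & n_comp (del_adj G B) 'I_s = r.+1.
  by apply: exact_subcut; rewrite n_comp_discrete.
case: (@arg_minnP _ B (fun B => n_comp (del_adj G B) 'I_s == r.+1)
         (fun B => #|B|)); first exact/eqP.
move=> B0 /eqP nB0 minB0; exists #|B0|.
  by split=> [|_ [B1 nB1 <-]]; [exists B0 | apply/minB0/eqP].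
have lower (D : 'M[K]_(r, m)) :
    (D <= A)%MS -> row_free D -> (#|B0| <= #|support D|)%N.
  move=> DA freeD; have [B1 sB1 nB1] := subcode_cut DA freeD.
  by apply: leq_trans (subset_leq_card sB1); apply/minB0/eqP.
split=> [|_ [D [DA freeD <-]]]; last exact: lower.
have [D [DA freeD sD]] := cut_subcode nB0; exists D; split=> //.
by apply/eqP; rewrite eqn_leq lower // subset_leq_card.
Qed.

Lemma rank_incidence : \rank A = (s - 1)%N.
Proof.
by rewrite -rank_ker_incidence mxrank_ker subKn // rank_leq_row.
Qed.

End Char2.

(** An edge is determined by its two ends, so x^(d-1) y with {x, y} the edge j
    evaluates to the j-th unit vector. Both exponents are positive because
    d >= 2. *)
Lemma generates_high_degree (K : fieldType) d : (2 <= d)%N ->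
  generates_code (incidence_mx G K) d (1%:M : 'M[K]_m).
Proof.
move=> d_ge2 v; split=> _; last exact: submx1.
have indicator j : exists f : {mpoly K[s]}, f \is d.-homog /\
    eval_cols (incidence_mx G K) f = delta_mx 0 j.
  have [x [y [xy Gj]]] := edgeP j.
  exists ('X_x ^+ d.-1 * 'X_y); split.
    have homX (z : 'I_s) : ('X_z : {mpoly K[s]}) \is 1.-homog.
      by rewrite dhomogX /= mdeg1.
    have := dhomogM (dhomogMn d.-1 (homX x)) (homX y).
    by rewrite mul1n addn1 prednK // ltnW.
  apply/rowP => k; rewrite !mxE mevalM rmorphXn /= !mevalXU !mxE /=.
  have [->|kj] := eqVneq k j; first by rewrite Gj set21 set22 expr1n mulr1.
  have [xk|_] := boolP (x \in G k); last first.
    by rewrite expr0n -subn1 subn_eq0 leqNgt d_ge2 mul0r.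
  have [yk|_] := boolP (y \in G k); last by rewrite mulr0.
  case/eqP: kj; apply: (@edge_inj s m G); rewrite Gj; apply/esym/eqP.
  by rewrite eqEcard cards2 xy edge_card andbT subUset !sub1set xk yk.
have [f homf] := fin_all_exists indicator.
exists (\sum_j v 0 j *: f j);
  first by apply: dhomog_lin_comb => j; case: (homf j).
rewrite eval_cols_sum [RHS]row_sum_delta; apply: eq_bigr => j _.
by case: (homf j) => _ ->.
Qed.

End Graphs.

(** * Conclusion *)

Lemma min_support_full (K : fieldType) r m : (r <= m)%N ->
  is_min (fun w => exists D : 'M[K]_(r, m),
    [/\ (D <= (1%:M : 'M[K]_m))%MS, row_free D & #|support D| = w]) r.
Proof.
move=> r_le;
have rank_pid : \rank (pid_mx r : 'M[K]_(r, m)) = r.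
  by rewrite rank_pid_mx.
split=> [|_ [D [_ /eqP rankD <-]]]; last first.
  by apply: leq_trans (rank_le_support D); rewrite rankD.
exists (pid_mx r); split; rewrite ?submx1 /row_free ?rank_pid //.
apply/eqP; rewrite eqn_leq andbC; apply/andP; split.
  by apply: leq_trans (rank_le_support _); rewrite rank_pid.
have widen_inj : injective (widen_ord r_le).
  by move=> i k /(congr1 val) /= ik; apply: val_inj.
rewrite -[X in (_ <= X)%N](card_ord r) -(card_codom widen_inj).
apply/subset_leq_card/subsetP => j /supportP[i]; rewrite mxE.
have [ij|_] := eqVneq (i : nat) (j : nat); last by rewrite /= eqxx.
by move=> _; apply/codomP; exists i; apply/val_inj; rewrite /= ij.
Qed.

Theorem theorem2p11 (n m : nat) (G : sgraph n.+1 m) (K : fieldType)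
    (connG : connected_graph G) (char2 : 2%N \in [pchar K]%R) :
  let s := n.+1 in
  let A := incidence_mx G K in
  let X := proj_points A in
  [/\ \dim (RM_code A 1) = (s - 1)%N,
      forall d : nat, (2 <= d)%N -> \dim (RM_code A d) = m,
      forall r : nat, (1 <= r <= s - 1)%N ->
        exists2 l : nat, is_edge_connectivity G r l & is_ghw X 1 r l
    & forall d r : nat, (2 <= d)%N -> (1 <= r <= m)%N -> is_ghw X d r r].
Proof.
move=> s A X.
have ghwE := is_ghwE (@col_incidence_neq0 _ _ G K) (@col_incidence_inj _ _ G K).
split=> [|d d_ge2|r /andP[_ r_le]|d r d_ge2 /andP[_ r_le]].
- by rewrite (dim_RM_code (generates_linear_forms A)) rank_incidence.
- by rewrite (dim_RM_code (generates_high_degree G (K := K) d_ge2)) mxrank1.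
- have [|l conn_l min_l] := @edge_connectivity_code _ _ G K char2 connG r.
    by move: r_le; rewrite subn1.
  by exists l => //; apply/(ghwE _ _ _ _ _ (generates_linear_forms A)).
apply/(ghwE _ _ _ _ _ (generates_high_degree G (K := K) d_ge2)).
exact: min_support_full.
Qed.
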